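(* Let $\theta>0$ and, for each positive integer $x$, let $X(t)=x-N_t$, where $N_t$ is a homogeneous Poisson process with intensity $\theta$ and $N_0=0$. Let $\tau(x)=\inf\{t>0: X(t)\le 0\}$, $A(x)=\int_0^{\tau(x)}X(t)\,dt$ and $V_{m,n}(x)=E[\tau(x)^mA(x)^n]$. For integers $m,n\ge 0$, $(m,n)\ne(0,0)$, write $V_{m,n}(x)=\sum_{k=1}^{m+2n}a_k^{(m,n)}x^k$ for all positive integers $x$, and let $\underline a_{m,n}=(a_1^{(m,n)},\dots,a_{m+2n}^{(m,n)})^T\in\mathbb{R}^{m+2n}$. Then for all integers $m,n\ge 1$ the matrix $A^{(m,n)}$ defined in the context is invertible and $$\underline a_{m,n}=\left(A^{(m,n)}\right)^{-1}B^{(m-1,n)}\begin{pmatrix}0\\ \underline a_{m-1,n}\end{pmatrix}+\left(A^{(m,n)}\right)^{-1}C^{(m,n-1)}\begin{pmatrix}0\\0\\ \underline a_{m,n-1}\end{pmatrix},$$ where the two column vectors on the right lie in $\mathbb{R}^{m+2n}$ and are obtained by prepending one zero to $\underline a_{m-1,n}\in\mathbb{R}^{m+2n-1}$ and two zeros to $\underline a_{m,n-1}\in\mathbb{R}^{m+2n-2}$, respectively.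
   Context: For $(m,n)\neq(0,0)$, $V_{m,n}$ restricted to positive integers is a polynomial of degree $m+2n$ with zero constant term, so the coefficients $a_k^{(m,n)}$ (depending on $\theta$) are well defined. The $(m+2n)\times(m+2n)$ real matrices are: $A^{(m,n)}_{i,j}=\binom{j}{i-1}(-1)^{j-i+1}\theta$ if $j\ge i$, and $A^{(m,n)}_{i,j}=0$ otherwise ($1\le i,j\le m+2n$); $B^{(m-1,n)}$ is the block-diagonal matrix $\mathrm{diag}(0,\,-m I_{m+2n-1})$, with a single leading zero diagonal entry; $C^{(m,n-1)}$ is the block-diagonal matrix $\mathrm{diag}(0,0,\,-n I_{m+2n-2})$, with two leading zero diagonal entries. $I_k$ is the $k\times k$ identity matrix. *)

(* Defs.v *)
From HB Require Import structures.
From mathcomp Require Import all_boot all_order all_algebra.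
From mathcomp Require Import all_classical all_reals all_analysis.
Set Implicit Arguments.
Unset Strict Implicit.
Unset Printing Implicit Defensive.
Import Order.TTheory GRing.Theory Num.Theory.
Import numFieldNormedType.Exports.
Local Open Scope classical_set_scope.
Local Open Scope ring_scope.

(* Taking some of the B i to be setT yields the product rule for every
   subfamily. *)
Definition mutually_independent (R : realType) (d d' : measure_display)
    (Omega : measurableType d) (T : measurableType d') (P : probability Omega R)
    (n : nat) (Y : 'I_n -> Omega -> T) : Prop :=
  forall B : 'I_n -> set T, (forall i, measurable (B i)) ->
    P (\bigcap_(i in [set: 'I_n]) Y i @^-1` B i) =
    (\prod_(i < n) P (Y i @^-1` B i))%E.

(* The time index set is [0, +oo[: the values N t for t < 0 are unconstrained.
   By monotonicity of the paths, the truncated subtractions are the true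
   increments. *)
Record poisson_process (R : realType) (d : measure_display)
    (Omega : measurableType d) (P : probability Omega R) (theta : R)
    (N : R -> Omega -> nat) : Prop := PoissonProcess {
  pp_measurable : forall t : R, 0 <= t -> measurable_fun [set: Omega] (N t) ;
  pp_start : forall w, N 0 w = 0%N ;
  pp_nondecreasing : forall w (s t : R), 0 <= s -> s <= t -> (N s w <= N t w)%N ;
  pp_right_continuous : forall w (t : R), 0 <= t -> N ^~ w @ t^'+ --> N t w ;
  pp_increment_law : forall s t : R, 0 <= s -> s < t -> forall k : nat,
    P [set w | (N t w - N s w)%N = k] = (poisson_pmf (theta * (t - s)) k)%:E ;
  pp_independent_increments : forall (n : nat) (t : nat -> R),
    0 <= t 0%N -> (forall i, t i <= t i.+1) ->
    mutually_independent P
      (fun (i : 'I_n) w => (N (t i.+1) w - N (t i) w)%N) }.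

Section FirstPassage.
Context {R : realType} {d : measure_display} {Omega : measurableType d}.
Variables (P : probability Omega R) (N : R -> Omega -> nat).

Definition X (x : nat) (t : R) (w : Omega) : R := x%:R - (N t w)%:R.

(* Equal to +oo when the path never reaches ]-oo, 0]. *)
Definition tau (x : nat) (w : Omega) : \bar R :=
  ereal_inf [set t%:E | t in [set t : R | 0 < t /\ X x t w <= 0]].

Definition area (x : nat) (w : Omega) : \bar R :=
  (\int[lebesgue_measure]_(t in [set t : R | (0 <= t)%R /\ (t%:E <= tau x w)%E])
     (X x t w)%:E)%E.

(* The library's 'E_P[_] only accepts real-valued functions. *)
Definition V (m n x : nat) : \bar R :=
  (\int[P]_w (tau x w ^+ m * area x w ^+ n))%E.

(* The entry of index k : 'I_(m + 2 * n) is the coefficient of x ^ (k + 1). *)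
Definition is_coefs (m n : nat) (a : 'cV[R]_(m + 2 * n)) : Prop :=
  forall x : nat, (0 < x)%N ->
    V m n x = (\sum_(k < m + 2 * n) a k 0 * x%:R ^+ k.+1)%:E.

(* is_coefs m n holds of at most one vector, since a polynomial is determined
   by its values at the positive integers. *)
Definition coefs (m n : nat) : 'cV[R]_(m + 2 * n) := xget 0 (@is_coefs m n).

End FirstPassage.

Section Matrices.
Variable R : realType.

(* Indices are shifted by one: the entry (i, j) here is A_{i+1,j+1}. *)
Definition Amx (theta : R) (m n : nat) : 'M[R]_(m + 2 * n) :=
  \matrix_(i, j)
    if (i <= j)%N then 'C(j.+1, i)%:R * (-1) ^+ (j - i).+1 * theta else 0.

(* Bmx m n is B^(m-1,n) and Cmx m n is C^(m,n-1); both act on dimension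
   m + 2n. *)
Definition Bmx (m n : nat) : 'M[R]_(m + 2 * n) :=
  diag_mx (\row_i if (i < 1)%N then 0 else - m%:R).

Definition Cmx (m n : nat) : 'M[R]_(m + 2 * n) :=
  diag_mx (\row_i if (i < 2)%N then 0 else - n%:R).

Lemma prepend1_dim (m n : nat) : (0 < m)%N -> (1 + (m.-1 + 2 * n) = m + 2 * n)%N.
Proof. by case: m. Qed.

Lemma prepend2_dim (m n : nat) : (0 < n)%N -> (2 + (m + 2 * n.-1) = m + 2 * n)%N.
Proof. by case: n => // n _; rewrite mulnS addnCA. Qed.

Definition prepend1 (m n : nat) (hm : (0 < m)%N) (a : 'cV[R]_(m.-1 + 2 * n)) :
    'cV[R]_(m + 2 * n) :=
  castmx (prepend1_dim n hm, erefl 1%N) (col_mx (0 : 'cV[R]_1) a).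

Definition prepend2 (m n : nat) (hn : (0 < n)%N) (a : 'cV[R]_(m + 2 * n.-1)) :
    'cV[R]_(m + 2 * n) :=
  castmx (prepend2_dim m hn, erefl 1%N) (col_mx (0 : 'cV[R]_2) a).

End Matrices.

(* Main.v *)
Require Import Defs.
From HB Require Import structures.
From mathcomp Require Import all_boot all_order all_algebra.
From mathcomp Require Import all_classical all_reals all_analysis.
From mathcomp Require Import measurable_realfun ring zify.
Import Order.TTheory GRing.Theory Num.Theory.
Local Open Scope ring_scope.

(** Write [f t] for the indicator of [N t < x], [g t] for the positive part of
    [x - N t], and [F], [G] for their integrals over [t, +oo[. Along every path
    [F 0] is the passage time and [G 0] the area, and by Tonelli
      [F 0 ^ m * G 0 ^ n] is the integral over [0, +oo[ of
      [m f F ^ (m - 1) G ^ n + n g F ^ m G ^ (n - 1)].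
    On the event [N t = k] with [k < x], [f t = 1], [g t = x - k], and [F t],
    [G t] are the passage time and the area of the process restarted at [t] from
    height [x - k]. Since the integral over [t] of the Poisson weight of [k] is
    [1 / theta], taking expectations gives
      [theta (V_{m,n}(x) - V_{m,n}(x - 1)) =
         m V_{m-1,n}(x) + n x V_{m,n-1}(x)].
    The matrix [A] expresses [theta (p(x - 1) - p(x))] in the coefficients of a
    polynomial [p] with [p(0) = 0], and it is triangular with nonzero diagonal. *)

Set Implicit Arguments.
Unset Strict Implicit.
Unset Printing Implicit Defensive.
Import numFieldNormedType.Exports.
Local Open Scope classical_set_scope.

(** * Products of tail integrals *)

Section Tail.
Context {R : realType}.
Local Notation mu := (@lebesgue_measure R).
Local Open Scope ereal_scope.

Definition tail (f : R -> \bar R) (t : R) : \bar R := \int[mu]_(s in `[t, +oo[) f s.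

(** The tail integrates over [s] a function [h] that is jointly measurable in [((t, w), s)], so this
    is the measurability half of Tonelli's theorem. The parameter in [T] will be the path. *)
Lemma measurable_tail d (T : measurableType d) (f : measurableTypeR R * T -> \bar R) :
  measurable_fun setT f -> (forall p, 0 <= f p) ->
  measurable_fun setT (fun p : measurableTypeR R * T => tail (fun s => f (s, p.2)) p.1).
Proof.
move=> mf f0.
pose h (q : (measurableTypeR R * T) * measurableTypeR R) :=
  if (q.1.1 <= q.2)%R then f (q.2, q.1.2) else 0.
have mh : measurable_fun setT h.
  apply: measurable_fun_if => //.
  - apply: measurable_fun_ler => //.
    by apply: measurableT_comp => //; exact: measurableT_comp.
  - apply: measurable_funTS; apply: measurableT_comp => //.
    by apply: measurable_fun_pair => //; apply: measurableT_comp.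
have h0 q : 0 <= h q by rewrite /h; case: ifP.
have := measurable_fun_fubini_tonelli_F (m2 := mu) h mh h0.
congr (measurable_fun _ _); apply/funext => -[t w] /=.
rewrite /fubini_F /tail [RHS]integral_mkcond; apply: eq_integral => s _.
by rewrite /h patchE/= mem_setE in_itv/= andbT.
Qed.

Lemma measurable_tail1 (f : R -> \bar R) :
  measurable_fun setT f -> (forall s, 0 <= f s) -> measurable_fun setT (tail f).
Proof.
move=> mf f0.
have mF := @measurable_tail _ unit (f \o fst) (measurableT_comp mf measurable_fst)
  (fun p => f0 p.1).
by apply: (measurableT_comp mF (_ : measurable_fun setT (fun t => (t, tt)))).
Qed.

Lemma tail_ge0 (f : R -> \bar R) t : (forall s, 0 <= f s) -> 0 <= tail f t.
Proof. by move=> f0; apply: integral_ge0 => s _. Qed.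

(** The product is the integral of [f s * g u] over the plane, cut along the diagonal: [u >= s]
    gives [f s * tail g s], and [u < s] gives the other term once Tonelli exchanges the
    variables. *)
Lemma integralM_tail (f g : R -> \bar R) :
  measurable_fun setT f -> measurable_fun setT g ->
  (forall s, 0 <= f s) -> (forall s, 0 <= g s) ->
  (\int[mu]_s f s) * (\int[mu]_s g s) =
  \int[mu]_s (f s * tail g s + tail f s * g s).
Proof.
move=> mf mg f0 g0.
rewrite ge0_integralD//=; first last.
- by apply: emeasurable_funM => //; exact: measurable_tail1.
- by move=> s _; rewrite mule_ge0// tail_ge0.
- by apply: emeasurable_funM => //; exact: measurable_tail1.
- by move=> s _; rewrite mule_ge0// tail_ge0.
pose h (p : measurableTypeR R * measurableTypeR R) :=
  if (p.2 < p.1)%R then f p.1 * g p.2 else 0.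
have mh : measurable_fun setT h.
  apply: measurable_fun_if => //; first exact: measurable_fun_ltr.
  apply: measurable_funTS; apply: emeasurable_funM => //;
    exact: measurableT_comp.
have h0 p : 0 <= h p by rewrite /h; case: ifP => // _; rewrite mule_ge0.
have ->: \int[mu]_s (tail f s * g s) =
    \int[mu]_s \int[mu]_u (if (u < s)%R then f s * g u else 0).
  rewrite (fubini_tonelli h)//.
  apply: eq_integral => s _.
  (* The diagonal is null, so the open tail matching the strict inequality in [h] may replace the
     closed one. *)
  rewrite /tail -integral_itv_obnd_cbnd; last exact: measurable_funTS.
  rewrite -ge0_integralZr//; last exact: measurable_funTS.
  rewrite integral_mkcond; apply: eq_integral => u _.
  by rewrite /h patchE/= mem_setE in_itv/= andbT.
rewrite -ge0_integralD//=; first last.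
- exact: (measurable_fun_fubini_tonelli_F (m2 := mu) h).
- by move=> s _; apply: integral_ge0 => u _; case: ifP => // _; rewrite mule_ge0.
- by apply: emeasurable_funM => //; exact: measurable_tail1.
- by move=> s _; rewrite mule_ge0// tail_ge0.
rewrite -ge0_integralZr//; last exact: integral_ge0.
apply: eq_integral => s _.
rewrite -ge0_integralZl// /tail -ge0_integralZl//; last exact: measurable_funTS.
rewrite [X in _ = X + _]integral_mkcond -ge0_integralD//=.
- apply: eq_integral => u _.
  rewrite patchE/= mem_setE in_itv/= andbT.
  by case: ltP; rewrite ?adde0 ?add0e.
- by move=> u _; rewrite patchE; case: ifP => // _; rewrite mule_ge0.
- apply/(measurable_restrictT _ _).1 => //.
  by apply: measurable_funTS; exact: measurable_funeM.
- by move=> u _; case: ifP => // _; rewrite mule_ge0.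
- apply: measurable_fun_if => //; first exact: measurable_fun_ltr.
  by apply: measurable_funTS; exact: measurable_funeM.
Qed.

(** This is [integralM_tail] for [f] and [g] cut off before [t]; at times [s >= t] the cut leaves
    their tails unchanged. *)
Lemma tailM (f g : R -> \bar R) t :
  measurable_fun setT f -> measurable_fun setT g ->
  (forall s, 0 <= f s) -> (forall s, 0 <= g s) ->
  tail f t * tail g t = tail (fun s => f s * tail g s + tail f s * g s) t.
Proof.
move=> mf mg f0 g0; pose D : set (measurableTypeR R) := `[t, +oo[%classic.
have mD : measurable D by exact: measurable_itv.
have tailD (h : R -> \bar R) s : (t <= s)%R -> tail (h \_ D) s = tail h s.
  move=> ts; rewrite /tail -integral_mkcondr; congr (integral _ _ _).
  apply/setIidl => u /=; rewrite !in_itv/= !andbT => su.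
  by rewrite /D/= in_itv/= andbT (le_trans ts).
have patch0 (h : R -> \bar R) : (forall s, 0 <= h s) -> forall s, 0 <= (h \_ D) s.
  by move=> h0 s; rewrite patchE; case: ifP.
transitivity ((\int[mu]_(s in D) f s) * (\int[mu]_(s in D) g s)); first by [].
rewrite [RHS]/tail -/D !(integral_mkcond D) integralM_tail//; first last.
- exact: patch0.
- exact: patch0.
- by apply/(measurable_restrictT _ _).1 => //; exact: measurable_funTS.
- by apply/(measurable_restrictT _ _).1 => //; exact: measurable_funTS.
apply: eq_integral => s _; rewrite ![in RHS]patchE !patchE.
case: ifPn => [|_]; last by rewrite mul0e mule0 adde0.
by rewrite mem_setE in_itv/= andbT => ts; rewrite !tailD.
Qed.

(** An integrated form of [F' = - f] with limit 0 at infinity that still makes sense when [F] is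
    infinite. The next lemmas are its product and power rules. *)
Definition is_tail (F f : R -> \bar R) :=
  [/\ measurable_fun setT f, forall s, 0 <= f s & F = tail f].

Lemma is_tailM F G f g : is_tail F f -> is_tail G g ->
  is_tail (fun t => F t * G t) (fun t => f t * G t + F t * g t).
Proof.
move=> [mf f0 ->] [mg g0 ->]; split.
- by apply: emeasurable_funD; apply: emeasurable_funM => //; exact: measurable_tail1.
- by move=> s; rewrite adde_ge0// mule_ge0// tail_ge0.
- by apply/funext => t; rewrite tailM.
Qed.

Lemma is_tailX F f m : is_tail F f ->
  is_tail (fun t => F t ^+ m.+1) (fun t => m.+1%:R%:E * (f t * F t ^+ m)).
Proof.
move=> tF; elim: m => [|m IH].
  have -> : (fun t => F t ^+ 1) = F by [].
  by have -> : (fun t => 1%:R%:E * (f t * F t ^+ 0)) = f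
    by apply/funext => t; rewrite mul1e mule1.
have [mf f0 FE] := tF.
have F0 t : 0 <= F t by rewrite FE tail_ge0.
have := is_tailM tF IH; congr (is_tail _ _); apply/funext => t.
rewrite muleCA (muleCA (F t)) -expeS -[in RHS]addn1 natrD EFinD ge0_muleDl ?lee_fin//.
by rewrite mul1e addeC.
Qed.

(** A zero exponent makes a junk power with [.-1] appear, and its factor 0 removes it. The pair
    [(0, 0)] is excluded because the constant 1 is not the tail of 0. *)
Lemma is_tailXX F G f g m n : is_tail F f -> is_tail G g -> (m, n) != (0, 0)%N ->
  is_tail (fun t => F t ^+ m * G t ^+ n)
    (fun t => m%:R%:E * (f t * F t ^+ m.-1 * G t ^+ n) +
              n%:R%:E * (g t * F t ^+ m * G t ^+ n.-1)).
Proof.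
move=> tF tG; case: m n => [|m] [|n]// _.
- have := is_tailX n tG; congr (is_tail _ _); apply/funext => t.
    by rewrite mul1e.
  by rewrite mul0e add0e mule1.
- have := is_tailX m tF; congr (is_tail _ _); apply/funext => t.
    by rewrite mule1.
  by rewrite mul0e adde0 mule1.
- have := is_tailM (is_tailX m tF) (is_tailX n tG).
  congr (is_tail _ _); apply/funext => t.
  by rewrite -!muleA (muleCA (F t ^+ _)) (muleCA (F t ^+ _) (g t)).
Qed.

End Tail.

Lemma emeasurable_funX (R : realType) d (T : measurableType d) (f : T -> \bar R) D n :
  measurable_fun D f -> measurable_fun D (fun x => f x ^+ n)%E.
Proof.
move=> mf; elim: n => [|n IH]; first exact: measurable_cst.
by under eq_fun do rewrite expeS; exact: emeasurable_funM.
Qed.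

Lemma fubini_tonelli_in (R : realType) d1 d2 (T1 : measurableType d1)
    (T2 : measurableType d2) (m1 : {sigma_finite_measure set T1 -> \bar R})
    (m2 : {sigma_finite_measure set T2 -> \bar R}) (A : set T1) (B : set T2)
    (f : T1 * T2 -> \bar R) :
  measurable A -> measurable B -> measurable_fun setT f -> (forall p, 0 <= f p)%E ->
  (\int[m1]_(x in A) \int[m2]_(y in B) f (x, y) =
   \int[m2]_(y in B) \int[m1]_(x in A) f (x, y))%E.
Proof.
move=> mA mB mf f0; pose h := f \_ (A `*` B).
have mh : measurable_fun setT h.
  apply/(measurable_restrictT _ _).1; first exact: measurableX.
  exact: measurable_funTS.
have h0 p : (0 <= h p)%E by rewrite /h patchE; case: ifP.
have hE x y : h (x, y) = if (x \in A) && (y \in B) then f (x, y) else 0%E.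
  by rewrite /h patchE in_setX.
have := fubini_tonelli (m1 := m1) (m2 := m2) h mh h0.
congr (_ = _).
  rewrite [RHS]integral_mkcond; apply: eq_integral => x _; rewrite patchE.
  case: ifPn => xA.
    rewrite [RHS]integral_mkcond; apply: eq_integral => y _.
    by rewrite hE xA patchE.
  by apply: integral0_eq => y _; rewrite hE (negbTE xA).
rewrite [RHS]integral_mkcond; apply: eq_integral => y _; rewrite patchE.
case: ifPn => yB.
  rewrite [RHS]integral_mkcond; apply: eq_integral => x _.
  by rewrite hE yB andbT patchE.
by apply: integral0_eq => x _; rewrite hE (negbTE yB) andbF.
Qed.

(** * Translation invariance of Lebesgue measure *)

Section Shift.
Context {R : realType}.
Local Notation mu := (@lebesgue_measure R).

(** Lebesgue measure is determined by its values on half-open intervals, and translation preserves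
    their lengths. *)
Lemma lebesgue_measure_shift (c : R) (A : set R) : measurable A ->
  pushforward mu (+%R c : _ -> measurableTypeR R) A = mu A.
Proof.
move=> mA.
have mc : measurable_fun setT (+%R c : measurableTypeR R -> measurableTypeR R).
  exact: measurable_funD.
pose phi : {mfun measurableTypeR R >-> measurableTypeR R} :=
  HB.pack (+%R c : measurableTypeR R -> measurableTypeR R)
    (isMeasurableFun.Build _ _ _ _ _ mc).
rewrite -[RHS]/(mu A) -[LHS]/(pushforward mu phi A).
apply/esym/lebesgue_measure_unique => //= _ [[a b]] _ <-.
rewrite /pushforward; have -> : +%R c @^-1` `]a, b] = `](a - c), (b - c)]%classic.
  by apply/seteqP; split => x /=; rewrite !in_itv/= ltrBlDl lerBrDl.
rewrite /= !lebesgue_measure_itv/= !lte_fin ltrD2r; case: ifP => // _.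
by rewrite -!EFinB opprB addrA subrK.
Qed.

Lemma tail_shift (f : R -> \bar R) (c : R) : measurable_fun setT f ->
  (forall s, 0 <= f s)%E ->
  (\int[mu]_(s in `[c, +oo[) f s = \int[mu]_(s in `[0%R, +oo[) f (c + s)%R)%E.
Proof.
move=> mf f0.
have -> : `[(0:R), +oo[%classic = (+%R c : _ -> measurableTypeR R) @^-1` `[c, +oo[.
  by apply/seteqP; split => x /=; rewrite !in_itv/= !andbT lerDl.
have mc : measurable_fun setT (+%R c : measurableTypeR R -> measurableTypeR R).
  exact: measurable_funD.
rewrite -(ge0_integral_pushforward (phi := +%R c : measurableTypeR R -> measurableTypeR R))//=.
- by apply: eq_measure_integral => //= A mA _; exact/esym/lebesgue_measure_shift.
- exact: measurable_funTS.
Qed.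

End Shift.

(** * Time integrals of Poisson weights *)

Section Pmf.
Context {R : realType}.
Local Notation mu := (@lebesgue_measure R).

(** The derivative of [p j] is [r (p (j-1) - p j)], so the sum over [j <= k] telescopes and [F k] is
    an antiderivative of [p k]. It rises from [- 1/r] at 0 to 0 at infinity. *)
Lemma integral_poisson_pmf (r : R) k : 0 < r ->
  (\int[mu]_(t in `]0%R, +oo[) (poisson_pmf (r * t) k)%:E = (r^-1)%:E)%E.
Proof.
move=> r0.
(* The Poisson weight without its guard on the rate, hence differentiable on the whole line. *)
pose p (j : nat) (t : R) : R := (r * t) ^+ j * j`!%:R^-1 * expR (- (r * t)).
pose F (k : nat) (t : R) : R := - (r^-1 * \sum_(j < k.+1) p j t).
have dp j t : is_derive (t : R) (1 : R) (p j) 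
   (if j is j'.+1 then r * (p j' t - p j t) else - r * p 0%N t).
  pose L (x : R) : R := r * x.
  have dL : is_derive t (1 : R) L r.
    have -> : L = r *: (id : R -> R) by apply/funext => x; rewrite /L !fctE.
    by apply: is_derive_eq; rewrite /GRing.scale/= mulr1.
  have dE : is_derive t (1 : R) (expR \o (- L)) (- r * expR (- (r * t))).
    have dNL : is_derive t (1 : R) (- L) (- r) by exact: is_deriveN.
    have := @is_derive1_comp _ expR (- L) t _ _ (is_derive_expR _) dNL.
    by rewrite mulrC.
  have -> : p j = j`!%:R^-1 *: (L ^+ j * (expR \o (- L))).
    apply/funext => x; rewrite /p /L !fctE/= /GRing.scale/= [RHS]mulrA; congr (_ * _).
    by rewrite mulrC.
  apply: is_derive_eq.
  rewrite /L; case: j => [|j]; rewrite /p !fctE /GRing.scale/=.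
    by rewrite fact0 invr1 expr0 !mul0r mulr0 addr0 !mul1r.
  have fj : j`!%:R != 0 :> R by rewrite pnatr_eq0 -lt0n fact_gt0.
  have j1 : 1 + j%:R != 0 :> R by rewrite nat1r pnatr_eq0.
  rewrite factS natrM -natr1 exprS; field.
  by rewrite fj addrC.
have dF j t : is_derive (t : R) (1 : R) (F j) (p j t).
  pose d (i : nat) := (if i is i'.+1 then r * (p i' t - p i t) else - r * p 0%N t).
  have -> : F j = - (r^-1 *: \sum_(i < j.+1) (p i : R -> R)).
    apply/funext => x; rewrite /F !fctE; congr (- (_ * _)).
    by rewrite fct_sumE.
  rewrite (_ : p j t = - (r^-1 *: \sum_(i < j.+1) d i)).
    by apply: is_deriveN; apply: is_deriveZ; apply: is_derive_sum.
  rewrite /GRing.scale/=; elim: j => [|j IH].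
    by rewrite big_ord1/= mulNr mulrN opprK mulKf// gt_eqF.
  rewrite big_ord_recr/= mulrDr opprD -IH mulKf ?gt_eqF//.
  by rewrite opprB addrC subrK.
have cp j : continuous (p j).
  move=> t; apply: differentiable_continuous.
  by apply/derivable1_diffP; have [] := dp j t.
transitivity (\int[mu]_(t in `]0%R, +oo[) (p k t)%:E)%E.
  apply: eq_integral => t; rewrite inE/= in_itv/= andbT => t0.
  by rewrite /poisson_pmf mulr_gt0.
rewrite integral_itv_obnd_cbnd//; last first.
  apply: measurable_funTS; apply/measurable_EFinP.
  by apply: continuous_measurable_fun.
rewrite (@ge0_continuous_FTC2y _ _ (F k) _ 0)//.
- rewrite sub0e /F; congr (_%:E).
  rewrite opprK big_ord_recl /p big1 => [|i _]; last first.
    by rewrite mulr0 expr0n/= !mul0r.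
  by rewrite mulr0 expr0 fact0 invr1 oppr0 expR0 addr0 !mulr1.
- move=> t t0; rewrite /p mulr_ge0 ?expR_ge0// mulr_ge0 ?invr_ge0//.
  by rewrite exprn_ge0// mulr_ge0// ltW.
- exact: continuous_subspaceT.
(* With [y = r t], the bound [expR y >= 1 + y^(j+1) / (j+1)!] reduces [p j t <= e] to
   [j + 1 <= e y], which holds for large [t]. *)
- have p0 j : p j t @[t --> +oo] --> 0.
    apply/cvgrPdist_le => e e0; near=> t.
    have t0 : 0 < t by near: t; exact: nbhs_pinfty_gt.
    have y0 : 0 < r * t by rewrite mulr_gt0.
    rewrite sub0r normrN ger0_norm; last first.
      by rewrite /p mulr_ge0 ?expR_ge0// mulr_ge0 ?invr_ge0 ?exprn_ge0// ltW.
    have te : j.+1%:R <= e * (r * t).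
      by rewrite mulrA -ler_pdivrMl ?mulr_gt0//.
    rewrite /p expRN ler_pdivrMr ?expR_gt0//.
    apply: (le_trans _ (ler_wpM2l (ltW e0) (expR_ge1Dxn j (ltW y0)))).
    rewrite factS natrM exprS ler_pdivrMr; last by rewrite ltr0n fact_gt0.
    have q0 : 0 <= (r * t) ^+ j by rewrite exprn_ge0// ltW.
    have a0 : 0 < j`!%:R :> R by rewrite ltr0n fact_gt0.
    have -> : e * (1 + r * t * (r * t) ^+ j / (j.+1%:R * j`!%:R)) * j`!%:R =
        e * j`!%:R + (e * (r * t)) * (r * t) ^+ j / j.+1%:R.
      have c0 : 1 + j%:R != 0 :> R by rewrite nat1r pnatr_eq0.
      by field; rewrite c0 gt_eqF.
    rewrite ler_wpDl ?mulr_ge0 ?(ltW e0) ?(ltW a0)//.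
    by rewrite ler_pdivlMr ?ltr0n// mulrC ler_wpM2r.
  rewrite -oppr0 -(mulr0 r^-1) /F; apply: cvgN; apply: cvgM; first exact: cvg_cst.
  elim: k.+1 => [|n IH].
    have -> : (fun t => \sum_(j < 0) p j t) = cst 0.
      by apply/funext => x; rewrite big_ord0.
    exact: cvg_cst.
  have -> : (fun t => \sum_(j < n.+1) p j t) =
      (fun t => \sum_(j < n) p j t + p n t).
    by apply/funext => x; rewrite big_ord_recr.
  by have := cvgD IH (p0 n); rewrite addr0; apply.
- apply: cvg_at_right_filter; apply: differentiable_continuous.
  by apply/derivable1_diffP; have [] := dF k 0.
- by move=> t _; rewrite derive1E; have [_ ->] := dF k t.
Unshelve. all: by end_near. Qed.

End Pmf.

(** * Restarted Poisson processes *)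

Section CondPoisson.
Context {R : realType} {d : measure_display} {Omega : measurableType d}.
Variables (P : probability Omega R) (theta : R).
Local Notation mu := (@lebesgue_measure R).
Local Notation RR := (measurableTypeR R).

(* [N] is a Poisson process under the conditional law given [E]. Quantifying over
   the event [E] makes this class stable under restarting the process at a time
   [t] on a level set of [N t], which is all that is needed of the Markov
   property. *)
Record cond_poisson (E : set Omega) (N : R -> Omega -> nat) : Prop := CondPoisson {
  cp_event : measurable E ;
  cp_measurable : forall t, 0 <= t -> measurable_fun setT (N t) ;
  cp_start : forall w, N 0 w = 0%N ;
  cp_nondecreasing : forall w s t, 0 <= s -> s <= t -> (N s w <= N t w)%N ;
  cp_right : forall w t k, 0 <= t -> (N t w < k)%N ->
    exists2 q, t < q & (N q w < k)%N ;
  cp_law : forall (n : nat) (t : nat -> R) (k : nat -> nat),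
    t 0%N = 0 -> (forall i, t i < t i.+1) ->
    P (E `&` \bigcap_(i < n) [set w | (N (t i.+1) w - N (t i) w)%N = k i]) =
    (P E * (\prod_(i < n) poisson_pmf (theta * (t i.+1 - t i)) (k i))%:E)%E }.

Definition shift_process (N : R -> Omega -> nat) (t : R) (s : R) (w : Omega) :=
  (N (t + s)%R w - N t w)%N.

Lemma measurable_level E N (t : R) k : cond_poisson E N -> 0 <= t ->
  measurable [set w | N t w = k].
Proof.
move=> cpN t0; have := cp_measurable cpN t0 measurableT (I : measurable [set k]).
by rewrite setTI.
Qed.

Lemma cond_poisson_pmf E N (t : R) k : cond_poisson E N -> 0 < t ->
  P (E `&` [set w | N t w = k]) = (P E * (poisson_pmf (theta * t) k)%:E)%E.
Proof.
(* [cp_law] takes a strictly increasing infinite sequence of times even for one increment; the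
   multiples of [t] provide one. *)
move=> cpN t0; have := @cp_law _ _ cpN 1%N (fun i => i%:R * t) (fun=> k).
rewrite mul0r => /(_ erefl); rewrite big_ord1 mul0r mul1r subr0 => <-; last first.
  by move=> i; rewrite ltr_pM2r// ltr_nat.
congr (P (E `&` _)); apply/seteqP; split=> w /=.
  by move=> Nw [|//] _ /=; rewrite mul1r mul0r (cp_start cpN) subn0.
by move=> /(_ 0%N isT) /=; rewrite mul1r mul0r (cp_start cpN) subn0.
Qed.

(** Translate the time grid by [t] and put 0 in front: the event [N t = k] becomes a condition on
    the first increment, and the law of [n + 1] increments of [N] factors as required. As [cp_law]
    involves no division, null events need no separate case. *)
Lemma cond_poisson_shift E N (t : R) k : cond_poisson E N -> 0 < t ->
  cond_poisson (E `&` [set w | N t w = k]) (shift_process N t).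
Proof.
move=> cpN t0; have mE := cp_event cpN; have mk := measurable_level k cpN (ltW t0).
have mono := cp_nondecreasing cpN.
split.
- exact: measurableI.
- move=> s s0; apply: measurable_fun_subn; apply: (cp_measurable cpN).
    by rewrite addr_ge0// ltW.
  exact: ltW.
- by move=> w; rewrite /shift_process addr0 subnn.
- by move=> w s u s0 su; rewrite leq_sub2r// mono ?lerD2l// addr_ge0// ltW.
- move=> w s j s0; rewrite /shift_process => h.
  have ts : 0 <= t + s by rewrite addr_ge0// ltW.
  have le : (N t w <= N (t + s)%R w)%N by rewrite mono ?lerDl// ltW.
  have [|q tq Nq] := @cp_right _ _ cpN w (t + s) (j + N t w)%N ts; first by lia.
  exists (q - t); first by rewrite ltrBrDr addrC.
  rewrite (addrC t) subrK; suff : (N t w <= N q w)%N by lia.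
  by rewrite mono// ?ltW// (le_lt_trans _ tq)// lerDl.
- move=> n u j u0 uS.
  have u_ge0 i : 0 <= u i.
    by elim: i => [|i IH]; [rewrite u0 | rewrite (le_trans IH)// ltW].
  pose t' i := if i is i'.+1 then t + u i' else 0.
  pose j' i := if i is i'.+1 then j i' else k.
  have t'S i : t' i < t' i.+1.
    by case: i => [|i] /=; rewrite ?u0 ?addr0// ltrD2l.
  have incr i w : (shift_process N t (u i.+1) w - shift_process N t (u i) w =
      N (t + u i.+1)%R w - N (t + u i)%R w)%N.
    rewrite /shift_process; have : (N t w <= N (t + u i)%R w)%N.
      by rewrite mono ?lerDl// ltW.
    by lia.
  have := @cp_law _ _ cpN n.+1 t' j' erefl t'S.
  rewrite big_ord_recl/= EFinM muleA subr0 u0 addr0 -(cond_poisson_pmf _ cpN)//.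
  rewrite (eq_bigr (fun i : 'I_n => poisson_pmf (theta * (u i.+1 - u i)) (j i))).
    2: by move=> i _ /=; rewrite opprD addrACA subrr add0r.
  move=> <-; rewrite -setIA; congr (P (E `&` _)).
  apply/seteqP; split => w /=.
    move=> [Nk H] [_|i /= /H /=]; last by rewrite incr.
    by rewrite /= u0 addr0 (cp_start cpN) subn0.
  move=> H; have := H 0%N isT; rewrite /= u0 addr0 (cp_start cpN) subn0 => Nk.
  split=> // i /= ilt; have := H i.+1 ilt; rewrite /= => <-; exact: incr.
Qed.

(* The guard [0 <= p.1] is there because [N] is unconstrained at negative times. *)
Definition below (N : R -> Omega -> nat) (k : nat) (p : RR * Omega) : \bar R :=
  ((0 <= p.1) && (N p.1 p.2 < k)%N)%:R%:E.

(** The positive part of [x - N t] written as a sum of indicators, so that its measurability follows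
    from that of [below]. *)
Definition height (N : R -> Omega -> nat) (x : nat) (p : RR * Omega) : \bar R :=
  (\sum_(k < x) below N k.+1 p)%E.

Lemma below_ge0 N k p : (0 <= below N k p)%E.
Proof. by rewrite lee_fin ler0n. Qed.

Lemma height_ge0 N x p : (0 <= height N x p)%E.
Proof. by apply: sume_ge0 => k _; exact: below_ge0. Qed.

Lemma heightE N x p : 0 <= p.1 -> height N x p = ((x - N p.1 p.2)%N%:R)%:E.
Proof.
move=> p0; rewrite /height /below p0/= sumEFin -natr_sum; congr (_%:R%:E).
under eq_bigr do rewrite ltnS.
rewrite -(big_mkord xpredT (fun i => nat_of_bool (N p.1 p.2 <= i)%N)).
elim: x => [|x IH]; first by rewrite big_geq.
rewrite big_nat_recr//= IH; move: (N _ _) => a.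
by case: leqP => h /=; rewrite ?addn0 ?addn1; lia.
Qed.

Lemma below_shift N t k j s w : 0 <= s -> 0 <= t ->
  (forall w s t, 0 <= s -> s <= t -> (N s w <= N t w)%N) ->
  N t w = k -> below N (k + j) (t + s, w) = below (shift_process N t) j (s, w).
Proof.
move=> s0 t0 mono Nk; rewrite /below /= addr_ge0// s0/= /shift_process.
have : (N t w <= N (t + s)%R w)%N by rewrite mono ?lerDl.
by rewrite Nk => h; rewrite ltn_subLR.
Qed.

Lemma measurable_below E N k : cond_poisson E N -> measurable_fun setT (below N k).
Proof.
move=> cpN; apply/measurable_EFinP.
(* By right continuity, [N s w < k] iff [N q w < k] for some rational [q > s]. *)
pose U := [set p : RR * Omega | 0 <= p.1 /\ (N p.1 p.2 < k)%N].
rewrite (_ : (fun p : RR * Omega => _) = \1_U); last first.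
  apply/funext => p; rewrite indicE; congr (nat_of_bool _)%:R.
  by apply/idP/idP; [move=> /andP[? ?]; rewrite inE | rewrite inE => -[-> ->]].
apply: measurable_indic.
have -> : U = \bigcup_(q : rat)
    (`[0, ratr q[%classic `*` [set w | (N (ratr q) w < k)%N]).
  apply/seteqP; split => [[s w] /= [s0 Nk]|[s w] /= [q _ [/=]]].
    have [q sq Nq] := cp_right cpN s0 Nk.
    have [r] := rat_in_itvoo sq; rewrite in_itv/= => /andP[sr rq].
    exists r => //; split => /=; first by rewrite in_itv/= s0 sr.
    apply: leq_ltn_trans Nq; apply: (cp_nondecreasing cpN); last exact: ltW.
    exact/ltW/(le_lt_trans s0).
  rewrite in_itv/= => /andP[s0 sq] Nq; split => //.
  by apply: leq_ltn_trans Nq; apply: (cp_nondecreasing cpN) => //; exact: ltW.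
apply: bigcupT_measurable_rat => q; have [q0|q0] := leP 0 (ratr q : R).
  apply: measurableX; first exact: measurable_itv.
  have := cp_measurable cpN q0 measurableT (I : measurable [set j | (j < k)%N]).
  by rewrite setTI.
rewrite set_itv_ge ?set0X; last by rewrite bnd_simp -leNgt ltW.
exact: measurable0.
Qed.

Lemma measurable_height E N x : cond_poisson E N -> measurable_fun setT (height N x).
Proof.
by move=> cpN; apply: emeasurable_sum => k; exact: measurable_below cpN.
Qed.

(* At time [0] these are [tau] and [area] along every path, infinite values
   included. *)
Definition duration N x (p : RR * Omega) := tail (fun s => below N x (s, p.2)) p.1.
Definition region N x (p : RR * Omega) := tail (fun s => height N x (s, p.2)) p.1.

Lemma duration_ge0 N x p : (0 <= duration N x p)%E.
Proof. by apply: tail_ge0 => s; exact: below_ge0. Qed.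

Lemma region_ge0 N x p : (0 <= region N x p)%E.
Proof. by apply: tail_ge0 => s; exact: height_ge0. Qed.

Lemma measurable_duration E N x : cond_poisson E N -> measurable_fun setT (duration N x).
Proof.
move=> cpN; apply: measurable_tail; first exact: measurable_below cpN.
by move=> p; exact: below_ge0.
Qed.

Lemma measurable_region E N x : cond_poisson E N -> measurable_fun setT (region N x).
Proof.
move=> cpN; apply: measurable_tail; first exact: measurable_height cpN.
by move=> p; exact: height_ge0.
Qed.

Lemma measurable_section d' (T : measurableType d') (f : RR * Omega -> T) w :
  measurable_fun setT f -> measurable_fun setT (fun s => f (s, w)).
Proof. by move=> mf; apply: measurableT_comp mf _. Qed.

Lemma duration_shift E N x k t w : cond_poisson E N -> 0 <= t -> N t w = k ->
  duration N (k + x) (t, w) = duration (shift_process N t) x (0, w).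
Proof.
move=> cpN t0 Nk; rewrite /duration /tail /= tail_shift; last 2 first.
- exact: (measurable_section _ (measurable_below _ cpN)).
- by move=> s; exact: below_ge0.
apply: eq_integral => s; rewrite inE/= in_itv/= andbT => s0.
by rewrite (below_shift _ s0 t0 _ Nk)//; exact: cp_nondecreasing cpN.
Qed.

Lemma region_shift E N x k t w : cond_poisson E N -> 0 <= t -> N t w = k ->
  region N (k + x) (t, w) = region (shift_process N t) x (0, w).
Proof.
move=> cpN t0 Nk; rewrite /region /tail /= tail_shift; last 2 first.
- exact: (measurable_section _ (measurable_height _ cpN)).
- by move=> s; exact: height_ge0.
apply: eq_integral => s; rewrite inE/= in_itv/= andbT => s0.
rewrite !heightE//=; last by rewrite addr_ge0.
rewrite /shift_process; congr (_%:R%:E).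
have : (N t w <= N (t + s)%R w)%N by rewrite (cp_nondecreasing cpN)// lerDl.
by rewrite Nk => kN; rewrite subnBA// addnC.
Qed.

(** The integral over [E] is not normalised by [P E]. *)
Definition moment E N m n x : \bar R :=
  (\int[P]_(w in E) (duration N x (0%R, w) ^+ m * region N x (0%R, w) ^+ n))%E.

(** The integrand that [is_tailXX] attaches to the powers of [duration] and [region]. *)
Definition rate N m n x (p : RR * Omega) : \bar R :=
  (m%:R%:E * (below N x p * duration N x p ^+ m.-1 * region N x p ^+ n) +
   n%:R%:E * (height N x p * duration N x p ^+ m * region N x p ^+ n.-1))%E.

Lemma rate_ge0 N m n x p : (0 <= rate N m n x p)%E.
Proof.
rewrite /rate adde_ge0// mule_ge0 ?lee_fin// !mule_ge0 ?expe_ge0//.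
all: by rewrite ?below_ge0 ?height_ge0 ?duration_ge0 ?region_ge0.
Qed.

Lemma measurable_rate E N m n x : cond_poisson E N -> measurable_fun setT (rate N m n x).
Proof.
move=> cpN; apply: emeasurable_funD; apply: measurable_funeM;
  apply: emeasurable_funM; (try apply: emeasurable_funM); try apply: emeasurable_funX.
all: try exact: measurable_below cpN.
all: try exact: measurable_height cpN.
all: try exact: measurable_duration cpN.
all: exact: measurable_region cpN.
Qed.

End CondPoisson.

(** * Moments *)

Section Moments.
Context {R : realType} {d : measure_display} {Omega : measurableType d}.
Variables (P : probability Omega R) (theta : R).
Local Notation mu := (@lebesgue_measure R).
Local Notation RR := (measurableTypeR R).
Local Notation cond_poisson := (cond_poisson P theta).
Local Notation moment := (moment P).

(** Apply [is_tailXX] at time 0 along each path, then Tonelli. Time 0 is dropped because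
    [cond_poisson_shift] restarts only at positive times. *)
Lemma momentE E N m n x : cond_poisson E N -> (m, n) != (0, 0)%N ->
  moment E N m n x =
  (\int[mu]_(t in `]0%R, +oo[) \int[P]_(w in E) rate N m n x (t, w))%E.
Proof.
move=> cpN mn0.
rewrite -(@fubini_tonelli_in _ _ _ _ _ P mu E _ (fun p => rate N m n x (p.2, p.1)))//=.
- apply: eq_integral => w _.
  have tF : is_tail (fun t => duration N x (t, w)) (fun s => below N x (s, w)).
    split => //; first exact: (measurable_section _ (measurable_below _ cpN)).
    by move=> s; exact: below_ge0.
  have tG : is_tail (fun t => region N x (t, w)) (fun s => height N x (s, w)).
    split => //; first exact: (measurable_section _ (measurable_height _ cpN)).
    by move=> s; exact: height_ge0.
  have [_ _ FE] := is_tailXX tF tG mn0.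
  rewrite (congr1 (@^~ 0) FE) /tail integral_itv_obnd_cbnd//.
  apply: measurable_funTS.
  exact: (measurable_section _ (measurable_rate _ _ _ cpN)).
- exact: cp_event cpN.
- apply: (measurableT_comp (measurable_rate _ _ _ cpN)).
  by apply: measurable_fun_pair.
- by move=> p; exact: rate_ge0.
Qed.

(** Both [below] and [height] vanish once [N t] reaches [x], so only the levels [k < x]
    contribute. *)
Lemma rate_split (N : R -> Omega -> nat) m n x t w : 0 <= t ->
  rate N m n x (t, w) =
  (\sum_(k < x) ((fun w => rate N m n x (t, w)) \_ [set w | N t w = k]) w)%E.
Proof.
move=> t0; have [xN|Nx] := leqP x (N t w).
  rewrite {1}/rate heightE//= /below/= t0 ltnNge xN/= (eqP xN).
  rewrite !mul0e !mule0 adde0 big1// => k _; rewrite patchE memNset//= => Nk.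
  by move: (ltn_ord k); rewrite -Nk ltnNge xN.
rewrite (bigD1 (Ordinal Nx))//= patchE mem_set//= big1 ?adde0// => k kN.
by rewrite patchE memNset//= => Nk; move/eqP: kN; apply; exact: val_inj.
Qed.

Lemma integral_rate E N m n x t : cond_poisson E N -> 0 < t ->
  (\int[P]_(w in E) rate N m n x (t, w) =
   \sum_(k < x)
     (m%:R%:E *
        moment (E `&` [set w | N t w = k]) (shift_process N t) m.-1 n (x - k) +
      (n * (x - k))%:R%:E *
        moment (E `&` [set w | N t w = k]) (shift_process N t) m n.-1 (x - k)))%E.
Proof.
move=> cpN t0; have mE := cp_event cpN.
have mr : measurable_fun setT (fun w => rate N m n x (t, w)).
  by apply: (measurableT_comp (measurable_rate _ _ _ cpN)).
under eq_integral => w _ do rewrite (rate_split _ _ _ _ _ (ltW t0)).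
rewrite ge0_integral_sum//=; first last.
- by move=> k w _; rewrite patchE; case: ifP => // _; exact: rate_ge0.
- move=> k; apply: measurable_funTS.
  apply/(measurable_restrictT _ _).1; last exact: measurable_funTS.
  exact: measurable_level cpN (ltW t0).
apply: eq_bigr => k _; rewrite -integral_mkcondr /moment.
have cpS := cond_poisson_shift k cpN t0; have mEk := cp_event cpS.
have kx := ltn_ord k.
have mD y : measurable_fun (E `&` [set w | N t w = k])
    (fun w => duration (shift_process N t) y (0, w)).
  apply: measurable_funTS.
  by apply: (measurableT_comp (measurable_duration _ cpS)).
have mG y : measurable_fun (E `&` [set w | N t w = k])
    (fun w => region (shift_process N t) y (0, w)).
  apply: measurable_funTS.
  by apply: (measurableT_comp (measurable_region _ cpS)).
have DG0 y a b w : (0 <= duration (shift_process N t) y (0%R, w) ^+ a *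
    region (shift_process N t) y (0%R, w) ^+ b)%E.
  by rewrite mule_ge0 ?expe_ge0 ?duration_ge0 ?region_ge0.
have mDG y a b : measurable_fun (E `&` [set w | N t w = k])
    (fun w => duration (shift_process N t) y (0%R, w) ^+ a *
              region (shift_process N t) y (0%R, w) ^+ b)%E.
  by apply: emeasurable_funM; apply: emeasurable_funX.
rewrite -!ge0_integralZl//; [|by rewrite lee_fin..].
rewrite -ge0_integralD//; first last.
- exact: measurable_funeM.
- by move=> w _; rewrite mule_ge0// lee_fin.
- exact: measurable_funeM.
- by move=> w _; rewrite mule_ge0// lee_fin.
apply: eq_integral => w; rewrite inE => -[_ /= Nk].
have tk := ltW t0.
rewrite /rate heightE//= /below/= tk Nk kx/= mul1e.
have -> : duration N x (t, w) = duration (shift_process N t) (x - k) (0, w).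
  by rewrite -(duration_shift _ cpN tk Nk) subnKC// ltnW.
have -> : region N x (t, w) = region (shift_process N t) (x - k) (0, w).
  by rewrite -(region_shift _ cpN tk Nk) subnKC// ltnW.
by rewrite natrM EFinM !muleA.
Qed.

(* The first argument is fuel, meant to be [m + n]. When [m = 0] the junk term of
   index [m.-1] is cancelled by its factor, and likewise for [n]. *)
Fixpoint moment_value (s m n x : nat) : R :=
  if s is s'.+1 then
    theta^-1 * \sum_(k < x) (m%:R * moment_value s' m.-1 n (x - k) +
                             (n * (x - k))%:R * moment_value s' m n.-1 (x - k))
  else 1.

Lemma moment_value_ge0 s m n x : 0 < theta -> 0 <= moment_value s m n x.
Proof.
move=> th0; elim: s m n x => //= s IH m n x.
by rewrite mulr_ge0 ?invr_ge0 ?(ltW th0)// sumr_ge0// => k _; rewrite addr_ge0// mulr_ge0.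
Qed.

(** Induction on [m + n] for all events and processes at once, since the induction hypothesis is
    applied to restarted processes on level sets. *)
Lemma momentP E N s m n x : 0 < theta -> (m + n)%N = s -> cond_poisson E N ->
  moment E N m n x = (P E * (moment_value s m n x)%:E)%E.
Proof.
move=> th0; elim: s m n x E N => [|s IH] m n x E N mns cpN.
  move: mns => /eqP; rewrite addn_eq0 => /andP[/eqP -> /eqP ->].
  rewrite /moment; under eq_integral do rewrite mule1.
  by rewrite integral_cst ?mul1e ?mule1//; exact: cp_event cpN.
rewrite (momentE _ cpN); last by apply: contra_eqN mns => /eqP[-> ->].
pose c k := m%:R * moment_value s m.-1 n (x - k) +
            (n * (x - k))%:R * moment_value s m n.-1 (x - k).
have c0 k : 0 <= c k by rewrite addr_ge0// mulr_ge0// moment_value_ge0.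
transitivity (\int[mu]_(t in `]0%R, +oo[)
    \sum_(k < x) (P E * (c k)%:E * (poisson_pmf (theta * t) k)%:E))%E.
  apply: eq_integral => t; rewrite inE/= in_itv/= andbT => t0.
  rewrite (integral_rate _ _ _ cpN t0); apply: eq_bigr => k _.
  have cpS := cond_poisson_shift k cpN t0.
  have rhsE : (P E * (c k)%:E * (poisson_pmf (theta * t) k)%:E =
     P (E `&` [set w | N t w = k]) * (c k)%:E)%E.
    by rewrite (cond_poisson_pmf _ cpN t0) muleAC.
  rewrite rhsE /c EFinD [RHS]ge0_muleDr; last 2 first.
  - by rewrite lee_fin mulr_ge0// moment_value_ge0.
  - by rewrite lee_fin mulr_ge0// moment_value_ge0.
  rewrite !EFinM.
  congr (_ + _)%E; rewrite [RHS]muleCA.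
    (* For [m = 0] the induction hypothesis does not cover [m.-1], but the factor 0 removes the
       term. *)
    case: (m) mns => [|m'] mns; first by rewrite !mul0e.
    by rewrite (IH _ _ _ _ _ _ cpS)//=; lia.
  case: (n) mns => [|n'] mns; first by rewrite !mul0e.
  by rewrite (IH _ _ _ _ _ _ cpS)//=; lia.
have mpmf k : measurable_fun (`]0%R, +oo[ : set RR)
    (fun t => (poisson_pmf (theta * t) k)%:E).
  apply: measurable_funTS; apply/measurable_EFinP.
  apply: (measurableT_comp (measurable_poisson_pmf k measurableT)).
  exact: mulrl_measurable.
have Pc0 k : (0 <= P E * (c k)%:E)%E by rewrite mule_ge0// lee_fin.
rewrite ge0_integral_sum//=; first last.
- by move=> k t _; rewrite mule_ge0// lee_fin poisson_pmf_ge0.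
- by move=> k; exact: measurable_funeM.
have Pfin : P E \is a fin_num by rewrite fin_num_measure//; exact: cp_event cpN.
under eq_bigr => k _.
  rewrite ge0_integralZl//; last by move=> t _; rewrite lee_fin poisson_pmf_ge0.
  (* Each level has the same expected occupation time [1 / theta], whatever [k] is. *)
  rewrite (integral_poisson_pmf k th0) -(fineK Pfin) -!EFinM.
  over.
rewrite sumEFin -[in RHS](fineK Pfin) -EFinM; congr (_%:E).
by rewrite -mulr_suml -mulr_sumr -mulrA (mulrC _ theta^-1).
Qed.

End Moments.

(** * Passage time and area along a path *)

Section Path.
Context {R : realType} {d : measure_display} {Omega : measurableType d}.
Variables (P : probability Omega R) (theta : R) (N : R -> Omega -> nat).
Local Notation mu := (@lebesgue_measure R).

Lemma cond_poisson_setT : 0 < theta -> poisson_process P theta N ->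
  cond_poisson P theta setT N.
Proof.
move=> th0 hN; split.
- exact: measurableT.
- exact: (pp_measurable hN).
- exact: (pp_start hN).
- exact: (pp_nondecreasing hN).
- move=> w t k t0 Nk.
  have rc := @pp_right_continuous _ _ _ _ _ _ hN w t t0.
  (* The topology of [nat] is discrete, so right convergence means equality just after [t]. *)
  have : \forall s \near t^'+, N s w = N t w.
    have /rc : nbhs (N t w) [set N t w] by rewrite nbhs_principalE.
    by [].
  move=> H; near (t^'+)%R => s.
  exists s; first by near: s; exact: nbhs_right_gt.
  suff -> : N s w = N t w by [].
  by near: s.
- move=> n t k t0 tS; rewrite setTI probability_setT mul1e.
  have t_ge0 i : 0 <= t i.
    by elim: i => [|i IH]; [rewrite t0 | rewrite (le_trans IH)// ltW].
  have := @pp_independent_increments _ _ _ _ _ _ hN n t.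
  rewrite t0 => /(_ (lexx _) (fun i => ltW (tS i))).
  move=> /(_ (fun i => [set k i]) (fun=> I)).
  rewrite (_ : \bigcap_(i in _) _ =
      \bigcap_(i < n) [set w | (N (t i.+1) w - N (t i) w)%N = k i]).
    move=> ->; rewrite -prodEFin; apply: eq_bigr => i _.
    by rewrite (pp_increment_law hN).
  apply/seteqP; split => w /= H i; last by move=> _; exact: (H i (ltn_ord i)).
  by move=> ilt; exact: (H (Ordinal ilt) I).
Unshelve. all: by end_near. Qed.

(** This lemma and [gt_tau] leave the time [tau] itself undecided, which is harmless since a single
    time is null. *)
Lemma lt_tau (t : R) x w : 0 < t -> (t%:E < tau N x w)%E -> (N t w < x)%N.
Proof.
move=> t0; apply: contraTT; rewrite -leqNgt -leNgt => xN.
apply: ereal_inf_lbound; exists t => //; split => //.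
by rewrite /X subr_le0 ler_nat.
Qed.

Lemma gt_tau (t : R) x w : (forall w s t, 0 <= s -> s <= t -> (N s w <= N t w)%N) ->
  0 <= t -> (tau N x w < t%:E)%E -> (x <= N t w)%N.
Proof.
move=> mono t0 /ereal_inf_lt[_ [s [s0 Xs] <-]]; rewrite lte_fin => st.
move: Xs; rewrite /X subr_le0 ler_nat => /leq_trans; apply.
by apply: mono; exact: ltW.
Qed.

Lemma tau_ge0 x w : (0 <= tau N x w)%E.
Proof. by apply: le_ereal_inf_tmp => _ [t [/ltW t0 _] <-]; rewrite lee_fin. Qed.

Lemma integral_tail_support (f : R -> \bar R) (c : R) : 0 <= c ->
  measurable_fun setT f -> (forall s, (0 <= f s)%E) -> (forall s, c < s -> f s = 0%E) ->
  (\int[mu]_(s in `[0%R, +oo[) f s = \int[mu]_(s in `[0%R, c[) f s)%E.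
Proof.
move=> c0 mf f0 fc.
rewrite (@itv_bndbnd_setU _ _ _ (BLeft c))//.
rewrite ge0_integral_setU//=; first last.
- apply/disj_setPS => s [/=]; rewrite !in_itv/= andbT => /andP[_ sc].
  by rewrite leNgt sc.
- exact: measurable_funTS.
rewrite -[X in (_ + X)%E]integral_itv_obnd_cbnd; last exact: measurable_funTS.
rewrite [X in (_ + X)%E]integral0_eq ?adde0// => s.
by rewrite /= in_itv/= andbT; exact: fc.
Qed.

Lemma tau_duration E x w : cond_poisson P theta E N -> (0 < x)%N ->
  tau N x w = duration N x (0, w).
Proof.
move=> cpN x0; rewrite /duration /tail/=.
have mono := cp_nondecreasing cpN.
have lt_below s : 0 <= s -> (s%:E < tau N x w)%E -> below N x (s, w) = 1%E.
  move=> s0 stau; rewrite /below/= s0 (_ : (_ < _)%N)//.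
  (* [tau] is an infimum over positive times, so time 0 is treated apart, using [N 0 w = 0 < x]. *)
  move: s0; rewrite le_eqVlt => /predU1P[<-|s0]; first by rewrite (cp_start cpN).
  exact: lt_tau.
have gt_below s : 0 <= s -> (tau N x w < s%:E)%E -> below N x (s, w) = 0%E.
  by move=> s0 stau; rewrite /below/= ltnNge (gt_tau mono s0 stau) andbF.
have := tau_ge0 x w.
case tauE : (tau N x w) => [c| |]//; rewrite ?lee_fin => c0.
- rewrite (integral_tail_support c0); first last.
  + by move=> s cs; rewrite gt_below ?tauE ?lte_fin// (le_trans c0)// ltW.
  + by move=> s; exact: below_ge0.
  + exact: (measurable_section _ (measurable_below _ cpN)).
  rewrite (eq_integral (cst 1%E)); last first.
    move=> s; rewrite inE/= in_itv/= => /andP[s0 sc].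
    by rewrite lt_below// tauE lte_fin.
  rewrite integral_cst// mul1e -[RHS]/(mu `[0, c[%classic) lebesgue_measure_itv/= lte_fin.
  by case: ltP => [_|c0']; rewrite ?sube0//; congr (_%:E); apply/eqP; rewrite eq_le c0 c0'.
- rewrite (eq_integral (cst 1%E)); last first.
    by move=> s; rewrite inE/= in_itv/= andbT => s0; rewrite lt_below// tauE ltry.
  by rewrite integral_cst// mul1e -[RHS]/(mu `[0%R, +oo[%classic) lebesgue_measure_itv/= ltry.
Qed.

(** Before [tau] the signed [X] equals [height], and afterwards [height] is 0. The endpoint [tau],
    included in [area], is null. *)
Lemma area_region E x w : cond_poisson P theta E N -> (0 < x)%N ->
  area N x w = region N x (0, w).
Proof.
move=> cpN x0; rewrite /region /tail/= /area.
have mono := cp_nondecreasing cpN.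
have lt_height s : 0 <= s -> (s%:E < tau N x w)%E -> height N x (s, w) = (X N x s w)%:E.
  move=> s0 stau; rewrite heightE//= /X natrB// ltnW//.
  move: s0; rewrite le_eqVlt => /predU1P[<-|s0]; first by rewrite (cp_start cpN).
  exact: lt_tau.
have gt_height s : 0 <= s -> (tau N x w < s%:E)%E -> height N x (s, w) = 0%E.
  by move=> s0 stau; rewrite heightE//= (eqP (gt_tau mono s0 stau)).
have mh : measurable_fun setT (fun s => height N x (s, w)).
  exact: (measurable_section _ (measurable_height _ cpN)).
have := tau_ge0 x w.
case tauE : (tau N x w) => [c| |]//; rewrite ?lee_fin => c0.
- rewrite (integral_tail_support c0)//; first last.
  + by move=> s cs; rewrite gt_height ?tauE ?lte_fin// (le_trans c0)// ltW.
  + by move=> s; exact: height_ge0.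
  have hX : {in `[0%R, c[%classic, (fun s => height N x (s, w)) =1 (fun s => (X N x s w)%:E)}.
    move=> s; rewrite inE/= in_itv/= => /andP[s0 sc].
    by rewrite lt_height// tauE lte_fin.
  transitivity (\int[mu]_(s in `[0%R, c[) (X N x s w)%:E)%E; last first.
    exact/esym/eq_integral.
  rewrite integral_itv_bndo_bndc.
    congr (integral _ _ _); apply/seteqP; split => s /=; rewrite in_itv/= lee_fin.
      by move=> [-> ->].
    by move=> /andP[].
  apply: (eq_measurable_fun _ hX); exact: measurable_funTS.
- rewrite (_ : [set _ | _] = `[0%R, +oo[%classic); last first.
    apply/seteqP; split => s /=; rewrite in_itv/= andbT leey; first by case.
    by [].
  apply: eq_integral => s; rewrite inE/= in_itv/= andbT => s0.
  by rewrite lt_height// tauE ltry.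
Qed.

Lemma V_moment_value m n x : 0 < theta -> poisson_process P theta N -> (0 < x)%N ->
  V P N m n x = (moment_value theta (m + n) m n x)%:E.
Proof.
move=> th0 hN x0; have cpN := cond_poisson_setT th0 hN.
rewrite -[RHS]mul1e -(@probability_setT _ _ _ P) -(momentP x th0 erefl cpN).
apply: eq_integral => w _.
by rewrite (tau_duration _ cpN) // (area_region _ cpN).
Qed.

End Path.

(** * Coefficients *)

Section Algebra.
Variable R : realType.

(** The matrix is upper triangular with diagonal entries [- (i + 1) theta]; [det_trig] is about
    lower triangular matrices, hence the transpose. *)
Lemma Amx_unit (theta : R) m n : 0 < theta -> Amx theta m n \in unitmx.
Proof.
move=> th0; rewrite unitmxE -det_tr det_trig; last first.
  apply/is_trig_mxP => i j ij; rewrite !mxE ifF//; apply/negbTE.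
  by rewrite -ltnNge.
rewrite unitfE; apply/prodf_neq0 => i _; rewrite !mxE leqnn subnn expr1.
by rewrite binSn mulrN1 mulNr oppr_eq0 mulf_neq0 ?gt_eqF.
Qed.

(** Column [k] lists the coefficients of [theta ((y - 1)^(k+1) - y^(k+1))]: the leading terms cancel
    and the powers [i <= k] remain. *)
Lemma Amx_horner (theta : R) m n (a : 'cV[R]_(m + 2 * n)) (y : R) :
  \sum_i (Amx theta m n *m a) i 0 * y ^+ i =
  theta * (\sum_k a k 0 * (y - 1) ^+ k.+1 - \sum_k a k 0 * y ^+ k.+1).
Proof.
rewrite -sumrB mulr_sumr; under eq_bigr do rewrite mxE mulr_suml.
rewrite exchange_big/=; apply: eq_bigr => k _.
under eq_bigr => i _ do rewrite mulrAC.
rewrite -mulr_suml -mulrBr mulrCA mulrC; congr (_ * _).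
rewrite (addrC y) exprDn big_ord_recr/= subnn binn expr0 mul1r mulr1n addrK.
have kD : (k < m + 2 * n)%N by [].
rewrite (big_ord_widen _ (fun i => (-1) ^+ (k.+1 - i) * y ^+ i *+ 'C(k.+1, i)) kD).
rewrite [in RHS]big_mkcond mulr_sumr; apply: eq_bigr => i _; rewrite mxE ltnS.
case: ifP => ik; last by rewrite mul0r mulr0.
by rewrite subSn// -mulr_natl; ring.
Qed.

Lemma horner_rVpolyX D (c : 'cV[R]_D) (x : R) :
  (rVpoly c^T).[x] * x = \sum_(k < D) c k 0 * x ^+ k.+1.
Proof.
rewrite horner_poly mulr_suml; apply: eq_bigr => k _.
by rewrite valK mxE -mulrA -exprSr.
Qed.

(** After division by [x], the difference is a polynomial of size at most [D] with the [D] roots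
    [1, ..., D]. *)
Lemma eq_coefs (D : nat) (a b : 'cV[R]_D) :
  (forall x : nat, (0 < x)%N ->
    \sum_(k < D) a k 0 * x%:R ^+ k.+1 = \sum_(k < D) b k 0 * x%:R ^+ k.+1) ->
  a = b.
Proof.
move=> ab; pose c := a - b.
pose p := rVpoly c^T.
have p0 : p = 0.
  apply/eqP/negPn/negP => p_neq0.
  have := max_poly_roots p_neq0 (rs := [seq i.+1%:R | i <- iota 0 D]).
  have rt : all (root p) [seq i.+1%:R | i <- iota 0 D].
    apply/allP => _ /mapP[i _ ->]; apply/eqP.
    apply: (@mulIf _ i.+1%:R); first by rewrite pnatr_eq0.
    rewrite mul0r horner_rVpolyX; under eq_bigr do rewrite !mxE mulrBl.
    by rewrite sumrB ab// subrr.
  have un : uniq [seq i.+1%:R : R | i <- iota 0 D].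
    rewrite map_inj_uniq ?iota_uniq// => i j /eqP; rewrite eqr_nat => /eqP[].
    exact.
  move=> /(_ rt un); rewrite size_map size_iota ltnNge => /negP; apply.
  exact: size_poly.
apply/eqP; rewrite -subr_eq0 -/c -[c]trmxK -[c^T]rVpolyK -/p p0.
by rewrite linear0 trmx0.
Qed.

End Algebra.

(** * The difference equation and its polynomial solution *)

Section Coefficients.
Context (R : realType) (theta : R) (theta_gt0 : 0 < theta).

(** The terms of index [k + 1] in the sum at [x + 1] are the terms of index [k] at [x], which leaves
    the term of index 0. *)
Lemma moment_valueS s m n x :
  moment_value theta s.+1 m n x.+1 = moment_value theta s.+1 m n x +
    theta^-1 * (m%:R * moment_value theta s m.-1 n x.+1 +
                (n * x.+1)%:R * moment_value theta s m n.-1 x.+1).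
Proof. by rewrite /= big_ord_recl mulrDr addrC subn0. Qed.

(** Both sides vanish at [x = 0], and by [Amx_horner] at [y = x + 1] they have the same
    increments. *)
Lemma moment_value_poly s m n (b : 'cV[R]_(m + 2 * n)) :
  (forall x : nat, (0 < x)%N ->
    m%:R * moment_value theta s m.-1 n x + (n * x)%:R * moment_value theta s m n.-1 x =
    - \sum_i b i 0 * x%:R ^+ i) ->
  forall x : nat, moment_value theta s.+1 m n x =
    \sum_k (invmx (Amx theta m n) *m b) k 0 * x%:R ^+ k.+1.
Proof.
move=> bE; set a := _ *m b.
have Aa : Amx theta m n *m a = b by rewrite mulKVmx// Amx_unit.
elim=> [|x IH].
  rewrite /= big_ord0 mulr0 big1// => k _.
  by rewrite expr0n mulr0.
rewrite moment_valueS bE// IH -Aa Amx_horner -natr1 addrK mulrN mulKf ?gt_eqF//.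
by rewrite opprB addrC subrK.
Qed.

(** A constant term is allowed here so that the case [m = n = 0], with value 1, can start the
    induction. *)
Let poly_values s m n := exists2 q : {poly R}, (size q <= (m + 2 * n).+1)%N &
  forall x : nat, (0 < x)%N -> moment_value theta s m n x = q.[x%:R].

(** The right-hand side of the difference equation has degree below [m + 2n]: lowering [m] costs one
    degree, and lowering [n] costs two, of which the factor [x] restores one. Its coefficients thus
    fit in a vector [b] of that length. *)
Lemma moment_value_coefsS s m n :
  (forall m n, (m + n)%N = s -> poly_values s m n) -> (m + n)%N = s.+1 ->
  exists a : 'cV[R]_(m + 2 * n), forall x : nat,
    moment_value theta s.+1 m n x = \sum_k a k 0 * x%:R ^+ k.+1.
Proof.
move=> polys mns.
(* The factor [m] stays inside the claim so that [q = 0] serves when [m = 0]. *)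
have [q1 [sq1 q1E]] : exists q : {poly R}, (size (m%:R *: q) <= m + 2 * n)%N /\
    forall x : nat, (0 < x)%N -> m%:R * moment_value theta s m.-1 n x = (m%:R *: q).[x%:R].
  case: m mns => [|m] mns.
    by exists 0; rewrite scaler0 size_poly0; split => // x _; rewrite mul0r horner0.
  have [|q sq qE] := polys m n; first by lia.
  exists q; split; first exact: leq_trans (size_scale_leq _ _) sq.
  by move=> x x0; rewrite hornerZ qE.
have [q2 [sq2 q2E]] : exists q : {poly R}, (size (n%:R *: ('X * q)) <= m + 2 * n)%N /\
    forall x : nat, (0 < x)%N ->
      (n * x)%:R * moment_value theta s m n.-1 x = (n%:R *: ('X * q)).[x%:R].
  case: n mns {q1 sq1 q1E} => [|n] mns.
    by exists 0; rewrite scale0r size_poly0; split => // x _; rewrite mul0r horner0.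
  have [|q sq qE] := polys m n; first by lia.
  exists q; split.
    apply: leq_trans (size_scale_leq _ _) _.
    apply: leq_trans (size_polyMleq _ _) _; rewrite size_polyX mulnS.
    by move: (size q) sq => z; lia.
  by move=> x x0; rewrite hornerZ hornerM hornerX qE// natrM mulrA.
pose p := m%:R *: q1 + n%:R *: ('X * q2).
have sp : (size p <= m + 2 * n)%N.
  by rewrite (leq_trans (size_polyD _ _))// geq_max sq1 sq2.
pose b : 'cV[R]_(m + 2 * n) := \col_i - p`_i.
have bE (x : nat) : (0 < x)%N ->
    m%:R * moment_value theta s m.-1 n x + (n * x)%:R * moment_value theta s m n.-1 x =
    - \sum_i b i 0 * x%:R ^+ i.
  move=> x0; rewrite q1E// q2E// -hornerD -/p (horner_coef_wide _ sp) -sumrN.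
  by apply: eq_bigr => i _; rewrite mxE mulNr opprK.
by eexists; exact: moment_value_poly bE.
Qed.

Lemma moment_value_polynomial s m n : (m + n)%N = s -> poly_values s m n.
Proof.
elim: s m n => [|s IH] m n mns.
  by exists 1 => [|x _]; rewrite ?size_poly1 ?hornerC.
have [a aE] := moment_value_coefsS IH mns.
exists (rVpoly a^T * 'X).
  apply: leq_trans (size_polyMleq _ _) _; rewrite size_polyX addn2/= ltnS.
  exact: size_poly.
by move=> x _; rewrite aE hornerM hornerX horner_rVpolyX.
Qed.

Lemma moment_value_coefs m n : (m, n) <> (0%N, 0%N) ->
  exists a : 'cV[R]_(m + 2 * n), forall x : nat,
    moment_value theta (m + n) m n x = \sum_k a k 0 * x%:R ^+ k.+1.
Proof.
move=> mn0; case mnE : (m + n)%N => [|s].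
  by case: mn0; move/eqP: mnE; rewrite addn_eq0 => /andP[/eqP-> /eqP->].
exact: moment_value_coefsS (@moment_value_polynomial s) mnE.
Qed.

Lemma sum_castmx D D' (e : D = D') (v : 'cV[R]_D) (F : nat -> R) :
  \sum_i castmx (e, erefl 1%N) v i 0 * F i = \sum_i v i 0 * F i.
Proof. by case: D' / e; rewrite castmx_id. Qed.

(** The weight [F] is arbitrary so that it can absorb the diagonal of [Bmx] as well as the powers of
    [y]. *)
Lemma sum_prepend1 m n (hm : (0 < m)%N) (a : 'cV[R]_(m.-1 + 2 * n)) (F : nat -> R) :
  \sum_i prepend1 hm a i 0 * F i = \sum_k a k 0 * F k.+1.
Proof.
rewrite sum_castmx big_split_ord/= big_ord1 col_mxEu mxE mul0r add0r.
by apply: eq_bigr => k _; rewrite col_mxEd.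
Qed.

Lemma sum_prepend2 m n (hn : (0 < n)%N) (a : 'cV[R]_(m + 2 * n.-1)) (F : nat -> R) :
  \sum_i prepend2 hn a i 0 * F i = \sum_k a k 0 * F k.+2.
Proof.
rewrite sum_castmx big_split_ord/= big1 ?add0r => [|i _].
  by apply: eq_bigr => k _; rewrite col_mxEd.
by rewrite col_mxEu mxE mul0r.
Qed.

Lemma sum_Bmx m n (hm : (0 < m)%N) (a : 'cV[R]_(m.-1 + 2 * n)) (y : R) :
  \sum_i (Bmx R m n *m prepend1 hm a) i 0 * y ^+ i =
  - (m%:R * \sum_k a k 0 * y ^+ k.+1).
Proof.
pose F i := (if (i < 1)%N then 0 else - m%:R) * y ^+ i.
transitivity (\sum_i prepend1 hm a i 0 * F i).
  by apply: eq_bigr => i _; rewrite mul_diag_mx !mxE /F mulrCA mulrA.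
rewrite sum_prepend1 mulr_sumr -sumrN; apply: eq_bigr => k _.
by rewrite /F/= mulNr mulrN mulrCA.
Qed.

(** Two prepended zeros move coefficient [k] to the power [k + 2], one more than its own power
    [k + 1]: this is the extra factor [y]. *)
Lemma sum_Cmx m n (hn : (0 < n)%N) (a : 'cV[R]_(m + 2 * n.-1)) (y : R) :
  \sum_i (Cmx R m n *m prepend2 hn a) i 0 * y ^+ i =
  - (n%:R * y * \sum_k a k 0 * y ^+ k.+1).
Proof.
pose F i := (if (i < 2)%N then 0 else - n%:R) * y ^+ i.
transitivity (\sum_i prepend2 hn a i 0 * F i).
  by apply: eq_bigr => i _; rewrite mul_diag_mx !mxE /F mulrCA mulrA.
rewrite sum_prepend2 mulr_sumr -sumrN; apply: eq_bigr => k _.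
by rewrite /F/= (exprS y k.+1); ring.
Qed.

End Coefficients.

(** * Existence and uniqueness of the coefficient vectors *)

Section IsCoefs.
Context (R : realType) (d : measure_display) (Omega : measurableType d).
Context (P : probability Omega R) (theta : R) (N : R -> Omega -> nat).
Context (theta_gt0 : 0 < theta) (hN : poisson_process P theta N).

Lemma is_coefsP m n (a : 'cV[R]_(m + 2 * n)) :
  is_coefs P N a <-> forall x : nat, (0 < x)%N ->
    moment_value theta (m + n) m n x = \sum_k a k 0 * x%:R ^+ k.+1.
Proof.
split=> aE x x0; have := aE x x0; rewrite (V_moment_value m n theta_gt0 hN x0).
  by case.
by move=> ->.
Qed.

Lemma is_coefs_unique m n (a b : 'cV[R]_(m + 2 * n)) :
  is_coefs P N a -> is_coefs P N b -> a = b.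
Proof.
move=> /is_coefsP aE /is_coefsP bE; apply: eq_coefs => x x0.
by rewrite -aE// bE.
Qed.

Lemma is_coefs_coefs m n : (m, n) <> (0%N, 0%N) -> is_coefs P N (coefs P N m n).
Proof.
move=> mn0; apply: xgetPex.
have [a aE] := moment_value_coefs theta_gt0 mn0.
by exists a; apply/is_coefsP => x _; exact: aE.
Qed.

End IsCoefs.

Theorem mainTheorem6 (R : realType) (d : measure_display)
    (Omega : measurableType d) (P : probability Omega R)
    (theta : R) (N : R -> Omega -> nat)
    (htheta : 0 < theta) (hN : poisson_process P theta N) :
  (forall m n : nat, (m, n) <> (0%N, 0%N) -> is_coefs P N (coefs P N m n)) /\
  (forall (m n : nat) (hm : (0 < m)%N) (hn : (0 < n)%N),
    Amx theta m n \in unitmx /\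
    coefs P N m n =
      invmx (Amx theta m n) *m Bmx R m n *m prepend1 hm (coefs P N m.-1 n) +
      invmx (Amx theta m n) *m Cmx R m n *m prepend2 hn (coefs P N m n.-1)).
Proof.
split=> [m n mn0|m n hm hn]; first exact: is_coefs_coefs htheta hN _ _ mn0.
split; first exact: Amx_unit.
rewrite -!mulmxA -mulmxDr.
(* As [m] and [n] are positive, none of the three pairs is [(0, 0)], so each [coefs] is a genuine
   coefficient vector and not the default of [xget]. *)
have mn0 : (m, n) <> (0%N, 0%N) by case=> m0; rewrite m0 in hm.
have mn1 : (m.-1, n) <> (0%N, 0%N) by case=> _ n0; rewrite n0 in hn.
have mn2 : (m, n.-1) <> (0%N, 0%N) by case=> m0; rewrite m0 in hm.
have smn : (m + n = (m.-1 + n).+1)%N by lia.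
apply: (is_coefs_unique htheta hN); first exact: is_coefs_coefs htheta hN _ _ mn0.
(* By uniqueness it suffices that the right-hand side represents [V]; in [moment_value_poly] the
   vector [b] is the sum of the [Bmx] and [Cmx] terms. *)
apply/(is_coefsP htheta hN) => x _; rewrite smn; apply: moment_value_poly => // y y0.
have /(is_coefsP htheta hN)/(_ y y0) aE := is_coefs_coefs htheta hN mn1.
have /(is_coefsP htheta hN)/(_ y y0) := is_coefs_coefs htheta hN mn2.
rewrite (_ : m + n.-1 = m.-1 + n)%N; last by lia.
move=> cE; rewrite aE cE.
under [in RHS]eq_bigr => i _ do rewrite mxE mulrDl.
by rewrite big_split/= sum_Bmx sum_Cmx opprD !opprK natrM.
Qed.
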